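(* For every integer $n\geq 0$, the polynomial $J_{2n+1}(x)$ is $\gamma$-positive. Thus $J_{2n+1}(x)$ is symmetric and unimodal.
   Context: For $k\in(0,1)$ let $\mathrm{sn}(u,k)$ be the Jacobian elliptic function, i.e. $x=\mathrm{sn}(u,k)$ is the inverse of the elliptic integral of the first kind $u=\int_0^x\frac{dt}{\sqrt{(1-t^2)(1-k^2t^2)}}$. The polynomials $J_{2n+1}(x)$ are defined by the Taylor expansion $\mathrm{sn}(u,k)=\sum_{n\geq 0}(-1)^nJ_{2n+1}(k^2)\frac{u^{2n+1}}{(2n+1)!}$; one has $\deg J_{2n+1}(x)=n$. For example $J_1(x)=1$, $J_3(x)=1+x$, $J_5(x)=1+14x+x^2$, $J_7(x)=1+135x+135x^2+x^3$. Let $f(x)=\sum_{i=0}^m f_ix^i\in\mathbb{R}[x]$ have degree $m$. It is unimodal if there is an index $r$ with $f_0\leq f_1\leq\cdots\leq f_r\geq f_{r+1}\geq\cdots\geq f_m$. It is symmetric if $f_i=f_{m-i}$ for $0\leq i\leq m$. A symmetric $f$ can be uniquely expanded as $f(x)=\sum_{k=0}^{\lfloor m/2\rfloor}\gamma_kx^k(1+x)^{m-2k}$, and $f$ is called $\gamma$-positive if it is symmetric and $\gamma_k\geq 0$ for all $0\leq k\leq\lfloor m/2\rfloor$. *)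

(* Defs.v *)
From HB Require Import structures.
From mathcomp Require Import all_boot all_order all_algebra.
From mathcomp Require Import all_classical all_reals all_analysis.

Set Implicit Arguments.
Unset Strict Implicit.
Unset Printing Implicit Defensive.

Import Order.TTheory GRing.Theory Num.Theory.
Import numFieldNormedType.Exports.

Local Open Scope classical_set_scope.
Local Open Scope ring_scope.

Definition ellipF_integrand (R : realType) (k t : R) : R :=
  (Num.sqrt ((1 - t ^+ 2) * (1 - k ^+ 2 * t ^+ 2)))^-1.

(* The oriented integral from 0 to x, for x of either sign. The integrand is 0
   at t = 1 and t = -1 because 0^-1 = 0, which does not affect the integral. *)
Definition ellipF (R : realType) (k x : R) : R :=
  if 0 <= x then
    \int[lebesgue_measure]_(t in `[0, x]) ellipF_integrand k t
  else - \int[lebesgue_measure]_(t in `[x, 0]) ellipF_integrand k t.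

(* sn(., k) on [-K, K], with K = ellipF k 1, as the inverse of the injection
   ellipF k on [-1, 1]. Outside [-K, K] the value is the default 0 instead of
   the periodic continuation; only the germ at 0 matters for the expansion. *)
Definition sn (R : realType) (k : R) : R -> R :=
  'pinv_(fun=> 0) `[-1, 1] (ellipF k).

(* J n stands for J_{2n+1}. The radius of validity may depend on k, but the
   polynomials may not, which determines J uniquely. *)
Definition sn_taylor_polys (R : realType) (J : nat -> {poly R}) : Prop :=
  forall k : R, 0 < k < 1 ->
    \forall u \near (0 : R),
      series (fun n => (-1) ^+ n * (J n).[k ^+ 2] *
                       (u ^+ n.*2.+1 / (n.*2.+1)`!%:R)) @ \oo --> sn k u.

Definition deg (R : nzSemiRingType) (f : {poly R}) : nat := (size f).-1.

Definition symmetric_poly (R : nzSemiRingType) (f : {poly R}) : Prop :=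
  forall i, (i <= deg f)%N -> f`_i = f`_(deg f - i).

Definition unimodal_poly (R : realType) (f : {poly R}) : Prop :=
  exists2 r, (r <= deg f)%N &
    (forall i, (i < r)%N -> f`_i <= f`_i.+1) /\
    (forall i, (r <= i < deg f)%N -> f`_i.+1 <= f`_i).

(* The gamma_k are unique, as the X^k (1 + X)^(m - 2k) are linearly
   independent. *)
Definition gamma_positive (R : realType) (f : {poly R}) : Prop :=
  symmetric_poly f /\
  exists2 gamma : nat -> R,
    f = \sum_(k < (deg f)./2.+1)
          gamma k *: ('X^k * (1 + 'X) ^+ (deg f - k.*2)) &
    forall k, (k <= (deg f)./2)%N -> 0 <= gamma k.

(* Main.v *)
(* With x = k^2, the function y = sn(u, k) satisfies
   y'^2 = (1 - y^2)(1 - x y^2), hence y'' = -(1 + x) y + 2 x y^3. Absorbing the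
   signs of the Taylor coefficients (that is, replacing u by i u), the
   J_{2n+1}(x) become the Taylor coefficients of the solution of
   w'' = (1 + x) w + 2 x w^3, w(0) = 0, w'(0) = 1. All signs are now positive,
   and giving 1 + x weight 1 and x weight 2 makes the recursion homogeneous, so
   J_{2n+1} is a nonnegative combination of the x^k (1 + x)^(n - 2k).
   On the analytic side, sn(u) = u h(u^2) for a power series h. Products of
   power series are avoided by working with polynomial expansions up to
   O(s^m) as s tends to 0 from the right. *)
Require Import Defs.
From mathcomp Require Import all_boot all_order all_algebra.
From mathcomp Require Import all_classical all_reals all_analysis.
From mathcomp Require Import measurable_realfun zify ring lra.

Set Implicit Arguments.
Unset Strict Implicit.
Unset Printing Implicit Defensive.

Import Order.TTheory GRing.Theory Num.Theory.
Import numFieldNormedType.Exports.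

Local Open Scope classical_set_scope.
Local Open Scope ring_scope.

(** * The elliptic integral and its inverse near 0 *)

Section EllipticIntegral.
Variables (R : realType) (k : R).
Hypothesis k01 : 0 < k < 1.
Notation mu := (@lebesgue_measure R).
Notation g := (ellipF_integrand k).

Definition sn_rhs (t : R) : R := (1 - t ^+ 2) * (1 - k ^+ 2 * t ^+ 2).

Lemma sn_rhs_itv t : `|t| < 1 -> 0 < sn_rhs t <= 1.
Proof.
have [k0 k1] := andP k01.
rewrite /sn_rhs -real_normK ?num_real// => t1.
set x := `|t|; have x0 : 0 <= x by rewrite /x.
have x21 : x ^+ 2 < 1 by rewrite expr_lt1.
have x20 : 0 <= x ^+ 2 by exact: exprn_ge0.
have k21 : k ^+ 2 < 1 by rewrite expr_lt1// ltW.
have k20 : 0 < k ^+ 2 by exact: exprn_gt0.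
have kx : k ^+ 2 * x ^+ 2 < 1 by nra.
by apply/andP; split; nra.
Qed.

Lemma ellipF_integrand_ge0 t : 0 <= g t.
Proof. by rewrite invr_ge0 sqrtr_ge0. Qed.

Lemma ellipF_integrand_ge1 t : `|t| < 1 -> 1 <= g t.
Proof.
move=> /sn_rhs_itv /andP[P0 P1]; rewrite /ellipF_integrand -/(sn_rhs t).
by rewrite invf_ge1 ?sqrtr_gt0// -sqrtr1 ler_wsqrtr.
Qed.

Lemma ellipF_integrand_sqr t : `|t| < 1 -> g t ^+ 2 * sn_rhs t = 1.
Proof.
move=> /sn_rhs_itv /andP[P0 P1]; rewrite /ellipF_integrand -/(sn_rhs t).
by rewrite exprVn sqr_sqrtr ?ltW// mulVf// gt_eqF.
Qed.

Lemma continuous_ellipF_integrand t : `|t| < 1 -> {for t, continuous g}.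
Proof.
move=> /sn_rhs_itv /andP[P0 P1]; apply: continuousV.
  by rewrite sqrtr_eq0 -ltNge.
apply: (@continuous_comp _ _ _ sn_rhs Num.sqrt); last exact: sqrt_continuous.
have -> : sn_rhs = horner ((1 - 'X ^+ 2) * (1 - (k ^+ 2)%:P * 'X ^+ 2)).
  by apply/funext => x; rewrite /sn_rhs !hornerE.
exact: continuous_horner.
Qed.

Lemma integrable_ellipF_integrand b : 0 <= b < 1 ->
  mu.-integrable `[0, b] (EFin \o g).
Proof.
move=> /andP[b0 b1]; apply: continuous_compact_integrable.
  exact: segment_compact.
apply: continuous_in_subspaceT => x; rewrite inE/= in_itv/= => /andP[x0 xb].
by apply: continuous_ellipF_integrand; rewrite ger0_norm//; lra.
Qed.

Lemma measurable_ellipF_integrand (x : R) : 0 <= x <= 1 ->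
  measurable_fun `[0, x] g.
Proof.
move=> /andP[x0 x1].
have : measurable_fun (`]0, 1[ : set R) g.
  apply: open_continuous_measurable_fun; first exact: interval_open.
  move=> t; rewrite inE/= in_itv/= => /andP[t0 t1].
  by apply: continuous_ellipF_integrand; rewrite gtr0_norm.
move=> /measurable_fun_itv_cc; apply: measurable_funS => //.
by apply: subset_itvl; rewrite bnd_simp.
Qed.

(** The integrand is at least 1 inside the interval, and cutting at 1/2 keeps away from the endpoint
    1, where it is 0. Extended reals leave room for an integral not yet known to be finite. *)
Lemma minr_le_integral_ellipF (x : R) : 0 <= x <= 1 ->
  ((Num.min x 2^-1)%:E <= \int[mu]_(t in `[0%R, x]) (g t)%:E)%E.
Proof.
move=> x01; have /andP[x0 x1] := x01.
set m := Num.min x _; have [mx m2] : m <= x /\ m <= 2^-1.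
  by rewrite /m !ge_min !lexx orbT.
have m0 : 0 <= m by rewrite le_min x0/= invr_ge0.
apply: (@le_trans _ _ (\int[mu]_(t in `[0%R, m]) (g t)%:E)%E); last first.
  apply: ge0_subset_integral => //.
  - by apply/measurable_EFinP; exact: measurable_ellipF_integrand.
  - by move=> t _; rewrite lee_fin ellipF_integrand_ge0.
  - by apply: subset_itvl; rewrite bnd_simp.
clearbody m; have -> : m%:E = (\int[mu]_(t in `[0%R, m]) (cst 1%:E t))%E.
  rewrite integral_cst//= lebesgue_measure_itv/= lte_fin mul1e oppr0 adde0.
  by rewrite lt_neqAle m0 andbT; have [<-|] := eqVneq 0 m.
apply: ge0_le_integral => //.
- have m1 : 0 <= m <= 1 by rewrite m0 (le_trans mx).
  by apply/measurable_EFinP; exact: measurable_ellipF_integrand.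
- move=> t; rewrite /= in_itv/= => /andP[t0 tm].
  by rewrite lee_fin ellipF_integrand_ge1// ger0_norm//; lra.
Qed.

Lemma is_derive_ellipF (x : R) : 0 < x < 1 -> is_derive x 1 (ellipF k) (g x).
Proof.
move=> /andP[x0 x1].
(* The midpoint of [x] and 1 gives an interval with [x] in its interior on which the integrand is
   still integrable. *)
have xu : x < (x + 1) / 2 by lra.
have u01 : 0 <= (x + 1) / 2 < 1 by lra.
have cx : {for x, continuous g}.
  by apply: continuous_ellipF_integrand; rewrite gtr0_norm.
have [dF F'] :=
  continuous_FTC1_closed xu (integrable_ellipF_integrand u01) x0 cx.
have near_F : \near x,
    (\int[mu]_(t in [set` `[0, x]]) g t)%R = ellipF k x.
  near=> y; rewrite /ellipF ifT//; apply: ltW; near: y.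
  exact: lt_nbhsr.
apply: near_eq_is_derive near_F _; rewrite -F' derive1E; exact/derivableP.
Unshelve. all: by end_near. Qed.

Lemma within_continuous_ellipF : {within `[0, 2^-1], continuous (ellipF k)}.
Proof.
have h01 : 0 <= (2^-1 : R) < 1 by lra.
have /andP[h0 _] := h01.
have := parameterized_integral_continuous h0 (integrable_ellipF_integrand h01).
apply: subspace_eq_continuous => x; rewrite inE/= in_itv/= => /andP[x0 _].
by rewrite /from_subspace /ellipF /parameterized_integral x0.
Qed.

Lemma ellipF_half : 2^-1 <= ellipF k 2^-1.
Proof.
have h01 : 0 <= (2^-1 : R) <= 1 by lra.
rewrite /ellipF; case: ifPn => [_|]; last by case/andP: h01 => ->.
have := minr_le_integral_ellipF h01; rewrite minxx => le_half.
rewrite -lee_fin (le_trans le_half)// /Rintegral fineK//.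
by apply: integrable_fin_num => //; apply: integrable_ellipF_integrand; lra.
Qed.

(* If the integral up to 1 were infinite, its real part would be the junk
   value 0, so injectivity on [-1, 1] is never needed for [0 < u]. *)
Lemma sn_small u : 0 < u < 2^-1 -> 0 < sn k u < 2^-1 /\ ellipF k (sn k u) = u.
Proof.
move=> /andP[u0 u2].
have F0 : ellipF k 0 = 0.
  by rewrite /ellipF lexx set_itv1 Rintegral_set1.
have [x xin Fx] : exists2 x, x \in `[0, 2^-1] & ellipF k x = u.
  apply: IVT within_continuous_ellipF _; first by rewrite invr_ge0.
  rewrite F0 ge_min le_max (ltW u0)/=; apply/orP; right.
  exact: le_trans (ltW u2) ellipF_half.
have u_im : (ellipF k @` `[-1, 1]) u.
  by exists x => //; move: xin; rewrite /= !in_itv/= => /andP[? ?]; lra.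
have Fsn : ellipF k (sn k u) = u by apply: pinvK; rewrite inE.
have : `[-1, 1]%classic (sn k u).
  have := @surjpinv_image_sub _ _ (fun=> 0) `[-1, 1] [set u] (ellipF k).
  by apply; [move=> _ ->|exists u].
rewrite /= in_itv/=; move: Fsn; set y := sn k u => Fsn /andP[yN1 y1].
suff [y0 yu] : 0 < y /\ y <= u by split => //; rewrite y0/=; lra.
(* A negative [y] would make [ellipF k y] nonpositive, against u > 0. *)
have [y0|yn0] := leP 0 y; last first.
  move: Fsn; rewrite /ellipF leNgt yn0/= => Fsn.
  have : 0 <= \int[mu]_(t in `[y, 0]) g t.
    by apply: Rintegral_ge0 => t _; exact: ellipF_integrand_ge0.
  lra.
have y_neq0 : y != 0 by apply: contra_eqN Fsn => /eqP ->; rewrite F0 lt_eqF.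
have {y_neq0}y0' : 0 < y by rewrite lt_def y_neq0.
split => //.
have y01 : 0 <= y <= 1 by rewrite y0.
have := minr_le_integral_ellipF y01; move: Fsn; rewrite /ellipF y0 /Rintegral.
(* A finite integral equals [u] and bounds min(y, 1/2), so u < 1/2 forces y <= u. An infinite one
   has real part 0, against u > 0. *)
case: (\int[mu]_(t in _) _)%E => [r /= ->| /=|//].
  by rewrite lee_fin minEle; case: ifP => // _; lra.
by move=> u_eq0; rewrite -u_eq0 ltxx in u0.
Qed.

End EllipticIntegral.

(** * Termwise derivatives and truncation of power series *)

Section PowerSeries.
Variable R : realType.
Implicit Types (c : R^nat) (s : R).

Lemma is_cvg_seriesS c : cvgn (series c) -> cvgn (series (fun n => c n.+1)).
Proof.
move=> cc.
have -> : series (fun n => c n.+1) = [sequence series c n.+1 - c 0%N]_n.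
  apply/funext => n.
  by rewrite /series/= big_nat_recl//= addrAC subrr add0r.
apply: is_cvgB; last exact: is_cvg_cst.
by apply/cvg_ex; exists (limn (series c)); rewrite cvg_shiftS.
Qed.

(** Comparison with the absolutely convergent series at the midpoint [w] of |z| and |x|: the factor
    n + 1 is absorbed by (n + 1) |z|^n <= w^(n+1) / (w - |z|). *)
Lemma is_cvg_pseries_diffs c x z :
  cvgn (pseries c x) -> `|z| < `|x| -> cvgn (pseries (pseries_diffs c) z).
Proof.
move=> cx zx; pose w := (`|z| + `|x|) / 2.
have zw : `|z| < w by rewrite /w; lra.
have wx : w < `|x| by rewrite /w; lra.
have w0 : 0 <= w by rewrite (le_trans _ (ltW zw)).
have wz0 : 0 < w - `|z| by rewrite subr_gt0.
have cw : cvgn (pseries (fun i => `|c i|) w).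
  by apply: is_cvg_pseries_inside_norm cx _; rewrite ger0_norm.
have {}cw : cvgn (series (fun n => (w - `|z|)^-1 * (`|c n.+1| * w ^+ n.+1))).
  exact: is_cvg_seriesZ (is_cvg_seriesS cw).
 apply: normed_cvg; apply: series_le_cvg cw => n //=.
  rewrite mulr_ge0 ?invr_ge0 ?(ltW wz0)//.
  by rewrite mulr_ge0 ?exprn_ge0.
rewrite /pseries_diffs !normrM mulrAC [leLHS]mulrC [leRHS]mulrCA.
apply: ler_wpM2l => //; rewrite ler_pdivlMl// normrX normr_nat.
(* (n + 1) |z|^n (w - |z|) <= w^(n+1) - |z|^(n+1) *)
apply: (@le_trans _ _ (w ^+ n.+1 - `|z| ^+ n.+1)); last first.
  by rewrite lerBlDr lerDl exprn_ge0.
rewrite subrXX ler_wpM2l ?(ltW wz0)//.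
rewrite mulr_natl -[X in _ *+ X](card_ord n.+1) -sumr_const.
apply: ler_sum => i _.
rewrite -[in leLHS](@subnK i n) -1?ltnS// exprD ler_wpM2r ?exprn_ge0//.
by rewrite lerXn2r ?qualifE//= ltW.
Qed.

(** For i >= n and |s| <= K, |c_i| |s|^i <= (|s| / K)^n |c_i| K^i, which bounds the tail uniformly
    in [s]. *)
Lemma pseries_trunc c K n : 0 < K -> cvgn (pseries (fun i => `|c i|) K) ->
  exists B, forall s, `|s| <= K ->
    `|limn (pseries c s) - \sum_(0 <= i < n) c i * s ^+ i| <= B * `|s| ^+ n.
Proof.
move=> K0 cK; exists (K ^- n * limn (pseries (fun i => `|c i|) K)) => s sK.
have cs : cvgn (pseries c s).
  apply: normed_cvg; apply: series_le_cvg cK => i //=.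
    by rewrite mulr_ge0// exprn_ge0// ltW.
  by rewrite normrM normrX ler_wpM2l// lerXn2r ?qualifE//= ltW.
set P := \sum_(_ <= _ < _) _.
have cvgP : `|pseries c s m - P| @[m --> \oo] --> `|limn (pseries c s) - P|.
  by apply: cvg_norm; apply: cvgB => //; exact: cvg_cst.
rewrite -(cvg_lim (@Rhausdorff R) cvgP).
apply: limr_le; first by apply/cvg_ex; eexists; exact: cvgP.
near=> m.
have nm : (n <= m)%N by near: m; exact: nbhs_infty_ge.
rewrite /pseries /series/= (@big_cat_nat _ _ _ n)//= -/P [P + _]addrC addrK.
rewrite (le_trans (ler_norm_sum _ _ _))//.
have le_lim : pseries (fun i => `|c i|) K m <=
    limn (pseries (fun i => `|c i|) K).
  apply: nondecreasing_cvgn_le => //.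
  by apply: nondecreasing_series => i _ _; rewrite mulr_ge0// exprn_ge0// ltW.
apply: (@le_trans _ _ (K ^- n * `|s| ^+ n *
    \sum_(n <= i < m) `|c i| * K ^+ i)); last first.
  rewrite mulrAC ler_wpM2r ?exprn_ge0//.
  rewrite ler_wpM2l ?invr_ge0 ?exprn_ge0 ?(ltW K0)//.
  rewrite (le_trans _ le_lim)// /pseries /series/=.
  rewrite [leRHS](@big_cat_nat _ _ _ n)//= lerDr.
  by apply: sumr_ge0 => i _; rewrite mulr_ge0// exprn_ge0// ltW.
rewrite mulr_sumr; apply: ler_sum_nat => i /andP[ni _].
rewrite normrM normrX mulrCA ler_wpM2l//.
rewrite -[in X in X <= _](subnK ni) -[in X in _ <= X](subnK ni) !exprD.
have : K ^+ n != 0 by rewrite expf_neq0// gt_eqF.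
move: (K ^+ n) => Kn Kn0.
rewrite [leRHS](_ : _ = K ^+ (i - n) * `|s| ^+ n); last by field.
by rewrite ler_wpM2r ?exprn_ge0// lerXn2r ?qualifE//= ltW.
Unshelve. all: by end_near. Qed.

End PowerSeries.

(** * Polynomial expansions up to O(s^m) at 0 from the right *)

Section GermExpansion.
Variable R : realType.
Implicit Types (f g : R -> R) (p q e : {poly R}).

(** Coefficients of [p] of index [m] and above are left free, so sums and products need no
    truncation. *)
Definition expands m f p :=
  exists B, \forall s \near 0^'+, `|f s - p.[s]| <= B * s ^+ m.

Lemma horner_bounded p : exists B, \forall s \near 0^'+, `|p.[s]| <= B.
Proof.
exists (`|p.[0]| + 1).
have cp : p.[s] @[s --> 0^'+] --> p.[0].
  by apply: cvg_at_right_filter; exact: continuous_horner.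
apply: cvgr_norm_le; first exact: cp.
by rewrite ltrDl.
Qed.

Lemma expands_bounded m f p : expands m f p ->
  exists B, \forall s \near 0^'+, `|f s| <= B.
Proof.
move=> [B fB]; have [C pC] := horner_bounded p; exists (`|B| + C).
near=> s; have s0 : 0 < s by near: s; exact: nbhs_right_gt.
have s1 : s <= 1 by near: s; exact: nbhs_right_le.
rewrite -(subrK p.[s] (f s)) (le_trans (ler_normD _ _))// lerD//.
  have sB : `|f s - p.[s]| <= B * s ^+ m by near: s.
  rewrite (le_trans sB)// (le_trans (ler_norm _))// normrM.
  by rewrite ler_piMr// ger0_norm ?exprn_ge0 ?exprn_ile1 ?ltW.
by near: s.
Unshelve. all: by end_near. Qed.

Lemma expandsD m f g p q : expands m f p -> expands m g q ->
  expands m (fun s => f s + g s) (p + q).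
Proof.
move=> [B fB] [C gC]; exists (B + C); near=> s.
rewrite hornerD opprD addrACA (le_trans (ler_normD _ _))// mulrDl lerD//.
  by near: s.
by near: s.
Unshelve. all: by end_near. Qed.

Lemma expandsN m f p : expands m f p -> expands m (fun s => - f s) (- p).
Proof.
move=> [B fB]; exists B; near=> s.
by rewrite hornerN -opprD normrN; near: s.
Unshelve. all: by end_near. Qed.

Lemma expandsM m f g p q : expands m f p -> expands m g q ->
  expands m (fun s => f s * g s) (p * q).
Proof.
move=> fp [C gC]; have [D fD] := expands_bounded fp.
have [B fB] := fp; have [E qE] := horner_bounded q.
exists (D * C + B * E); near=> s.
have s0 : 0 < s by near: s; exact: nbhs_right_gt.
rewrite hornerM [X in `|X|](_ : _ =
  f s * (g s - q.[s]) + (f s - p.[s]) * q.[s]); last by ring.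
rewrite (le_trans (ler_normD _ _))// !normrM mulrDl.
rewrite -[D * _ * _]mulrA [B * _ * _]mulrAC lerD//.
  by apply: ler_pM => //; near: s.
by apply: ler_pM => //; near: s.
Unshelve. all: by end_near. Qed.

Lemma expandsW m n f p : (n <= m)%N -> expands m f p -> expands n f p.
Proof.
move=> nm [B fB]; exists `|B|; near=> s.
have s0 : 0 < s by near: s; exact: nbhs_right_gt.
have s1 : s <= 1 by near: s; exact: nbhs_right_le.
have sB : `|f s - p.[s]| <= B * s ^+ m by near: s.
rewrite (le_trans sB)// (le_trans (ler_norm _))// normrM ler_wpM2l//.
rewrite ger0_norm ?exprn_ge0 ?(ltW s0)//.
by apply: ler_wiXn2l => //; exact: ltW.
Unshelve. all: by end_near. Qed.

Lemma near_eq_expands m f g p : (\forall s \near 0^'+, f s = g s) ->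
  expands m f p -> expands m g p.
Proof.
move=> fg [B fB]; exists B; near=> s.
have <- : f s = g s by near: s.
by near: s.
Unshelve. all: by end_near. Qed.

(** Uniqueness of expansions: the limit at 0 kills the constant term, and dividing by s > 0 lowers
    [m] by one. *)
Lemma expands0_coef m e : expands m (fun=> 0) e ->
  forall i, (i < m)%N -> e`_i = 0.
Proof.
elim: m e => // m IH e [B eB].
have e0 : e.[0] = 0.
  have ce : `|e.[s]| @[s --> 0^'+] --> `|e.[0]|.
    by apply: cvg_norm; apply: cvg_at_right_filter; exact: continuous_horner.
  have cB : (B%:P * 'X^(m.+1)).[s] @[s --> 0^'+] --> (B%:P * 'X^(m.+1)).[0].
    by apply: cvg_at_right_filter; exact: continuous_horner.
  apply/eqP; rewrite -normr_le0.
  have B0 : (B%:P * 'X^(m.+1)).[0] = 0 by rewrite !hornerE expr0n mulr0.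
  rewrite -[leRHS]B0; apply: (ler_cvg_to ce cB); near=> s.
  rewrite hornerM hornerC hornerXn -normrN -[- _]add0r.
  by near: s.
have /factor_theorem[d de] : root e 0 by rewrite rootE e0.
have {IH} d0 : forall i, (i < m)%N -> d`_i = 0.
  apply: IH; exists B; near=> s.
  have s0 : 0 < s by near: s; exact: nbhs_right_gt.
  have : `|0 - e.[s]| <= B * s ^+ m.+1 by near: s.
  rewrite de !sub0r !normrN hornerM hornerXsubC subr0 normrM (gtr0_norm s0).
  by rewrite exprSr mulrA ler_pM2r.
move=> [_|i im]; first by rewrite -horner_coef0.
by rewrite de subr0 coefMX d0.
Unshelve. all: by end_near. Qed.

End GermExpansion.

(** * From the first-order to the second-order equation, formally *)

Section FormalODE.
Variable K : idomainType.
Implicit Types (x : K) (p q L : {poly K}).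

(** If the lower coefficients of [L] vanish, the i-th coefficient of the product reduces to q_0
    L_i. *)
Lemma coef_mul0_cancel q L m : q`_0 != 0 ->
  (forall i, (i < m)%N -> (q * L)`_i = 0) ->
  forall i, (i < m)%N -> L`_i = 0.
Proof.
move=> q0 qL; elim/ltn_ind => i IH im.
have := qL i im; rewrite coefM big_ord_recl/= subn0 big1 => [|j _].
  by rewrite addr0 => /eqP; rewrite mulf_eq0 (negPf q0) => /eqP.
have ji : (i - lift ord0 j < i)%N.
  by rewrite ltn_subrL/= (leq_ltn_trans _ (ltn_ord j)).
by rewrite IH ?mulr0// (ltn_trans ji).
Qed.

(* A polynomial [p] encodes the odd function y(u) = u p(u^2), and [odd_deriv p]
   encodes y'. The two defects below encode y'^2 - (1 - y^2)(1 - x y^2) and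
   (y'' + (1 + x) y - 2 x y^3) / u. *)
Definition odd_deriv p := p + 2%:R *: ('X * p^`()).

Definition first_order_defect x p :=
  odd_deriv p ^+ 2 - (1 - 'X * p ^+ 2) * (1 - x%:P * ('X * p ^+ 2)).

Definition second_order_defect x p :=
  2%:R *: (odd_deriv p)^`() + (1 + x)%:P * p - (2%:R * x)%:P * ('X * p ^+ 3).

(** Differentiating y'^2 - (1 - y^2)(1 - x y^2) in u gives 2 y' (y'' + (1 + x) y - 2 x y^3). With s
    = u^2 one has d/du = 2u d/ds, which removes the 2 and accounts for the division by u. *)
Lemma deriv_first_order_defect x p :
  (first_order_defect x p)^`() = odd_deriv p * second_order_defect x p.
Proof.
rewrite /first_order_defect /second_order_defect.
set q := odd_deriv p.
have dXp : ('X * p ^+ 2)^`() = p * q.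
  rewrite derivM derivX mul1r expr2 derivM /q /odd_deriv.
  rewrite -!mul_polyC; ring.
rewrite derivB expr2 !derivM !derivB dXp derivM dXp -polyC1 !derivC mul0r add0r.
rewrite -!mul_polyC; ring.
Qed.

Lemma second_order_defect_coef x p m : p`_0 != 0 ->
  (forall i, (i < m.+1)%N -> (first_order_defect x p)`_i = 0) ->
  forall i, (i < m)%N -> (second_order_defect x p)`_i = 0.
Proof.
move=> p0 E0; apply: (@coef_mul0_cancel (odd_deriv p)).
  by rewrite coefD coefZ coefXM mulr0 addr0.
by move=> i im; rewrite -deriv_first_order_defect coef_deriv E0 ?mul0rn.
Qed.

Lemma coef_odd_deriv p i : (odd_deriv p)`_i = (i.*2.+1)%:R * p`_i.
Proof.
rewrite coefD coefZ coefXM; case: i => [|i] /=.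
  by rewrite mulr0 addr0 mul1r.
rewrite coef_deriv -[_ *+ i.+1]mulr_natl -[_.*2.+1]addn1 -mul2n natrD natrM.
by ring.
Qed.

(** This is the recursion for the coefficients: the cubic term involves only those of index below
    [i]. *)
Lemma coef_second_order_defect x p i : (second_order_defect x p)`_i =
  (i.+1.*2 * i.+1.*2.+1)%:R * p`_i.+1 + (1 + x) * p`_i
    - 2%:R * x * ('X * p ^+ 3)`_i.
Proof.
rewrite coefB coefD !coefCM coefZ coef_deriv coef_odd_deriv.
by rewrite -[_ *+ i.+1]mulr_natl !mulrA -!natrM mul2n.
Qed.

End FormalODE.

(** * The differential equation for the Taylor series of sn *)

Section SnSeries.
Variables (R : realType) (k : R) (c : R^nat).
Hypothesis k01 : 0 < k < 1.
Hypothesis sn_series : \forall u \near (0 : R),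
  series (fun n => c n * u ^+ n.*2.+1) @ \oo --> sn k u.

Let h s := limn (pseries c s).
Let h' s := limn (pseries (pseries_diffs c) s).

Lemma sn_pseries_cvg : exists2 r : R, 0 < r &
  cvgn (pseries c r) /\ cvgn (pseries (pseries_diffs c) r) /\
  cvgn (pseries (pseries_diffs (pseries_diffs c)) r).
Proof.
have /nbhs_ballP[e /= e0 he] := sn_series.
pose u := e / 2; have u0 : 0 < u by rewrite divr_gt0.
have cu : cvgn (series (fun n => c n * u ^+ n.*2.+1)).
  apply/cvg_ex; exists (sn k u); apply: he.
  by rewrite /ball/= sub0r normrN gtr0_norm// /u; lra.
have cu2 : cvgn (pseries c (u ^+ 2)).
  rewrite /pseries (_ : (fun n => _) =
    (fun n => u^-1 * (c n * u ^+ n.*2.+1))).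
    exact: is_cvg_seriesZ cu.
  apply/funext => n.
  by rewrite [u ^+ n.*2.+1]exprS (mulrCA (c n)) mulKf ?gt_eqF// -exprM mul2n.
have w0 : 0 < u ^+ 2 by exact: exprn_gt0.
have norm_lt (a b : R) : 0 < a -> a < b -> `|a| < `|b|.
  by move=> a0 ab; rewrite !gtr0_norm// (lt_trans a0).
have cw2 : cvgn (pseries (pseries_diffs c) (u ^+ 2 / 2)).
  by apply: is_cvg_pseries_diffs cu2 _; apply: norm_lt; lra.
(* Each derived series costs a strict shrinking of the radius, whence u^2 > u^2 / 2 > u^2 / 3. *)
exists (u ^+ 2 / 3); first lra.
split; [|split].
- by apply: is_cvg_pseries_inside cu2 _; apply: norm_lt; lra.
- by apply: is_cvg_pseries_inside cw2 _; apply: norm_lt; lra.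
- by apply: is_cvg_pseries_diffs cw2 _; apply: norm_lt; lra.
Qed.

Lemma near_snE : \forall u \near (0 : R), sn k u = u * h (u ^+ 2).
Proof.
have [r r0 [cr _]] := sn_pseries_cvg.
near=> u.
have ur : `|u ^+ 2| < `|r|.
  rewrite normrX (gtr0_norm r0).
  have ur : `|u| < r by near: u; exact: (@nbhs0_lt R R^o).
  have u1 : `|u| < 1 by near: u; exact: (@nbhs0_lt R R^o).
  by rewrite (le_lt_trans _ ur)// expr2 ler_piMr// ltW.
have cu : series (fun n => c n * u ^+ n.*2.+1) @ \oo --> sn k u by near: u.
have : series (fun n => c n * u ^+ n.*2.+1) @ \oo --> u * h (u ^+ 2).
  have -> : series (fun n => c n * u ^+ n.*2.+1) =
      (fun n => u * pseries c (u ^+ 2) n).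
    apply/funext => n; rewrite /pseries /series/= mulr_sumr.
    by apply: eq_bigr => i _; rewrite exprS mulrCA -exprM mul2n.
  apply: cvgMl_tmp; exact: is_cvg_pseries_inside cr ur.
by move=> /(cvg_unique _ cu); apply.
Unshelve. all: by end_near. Qed.

Lemma sn_ode : \forall s \near 0^'+, 0 < h s /\
  (h s + 2 * (s * h' s)) ^+ 2 -
    (1 - s * h s ^+ 2) * (1 - k ^+ 2 * (s * h s ^+ 2)) = 0.
Proof.
have [r r0 [c0 [c1 c2]]] := sn_pseries_cvg.
have /nbhs_ballP[e /= e0 he] := near_snE.
have snE u : 0 < u < e -> sn k u = u * h (u ^+ 2).
  move=> /andP[u0 ue]; apply: he.
  by rewrite /ball/= sub0r normrN gtr0_norm.
have e20 : 0 < e ^+ 2 by rewrite exprn_gt0.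
have h20 : 0 < (2^-1 : R) ^+ 2 by rewrite exprn_gt0// invr_gt0.
near=> s.
have s0 : 0 < s by near: s; exact: nbhs_right_gt.
have sr : s < r by near: s; exact: nbhs_right_lt.
have se : s < e ^+ 2 by near: s; exact: nbhs_right_lt.
have s2 : s < 2^-1 ^+ 2 by near: s; exact: nbhs_right_lt.
pose u := Num.sqrt s.
have u0 : 0 < u by rewrite sqrtr_gt0.
have us : u ^+ 2 = s by rewrite sqr_sqrtr// ltW.
have ue : u < e by rewrite -(ltr_pXn2r (n := 2)) ?qualifE/= ?us ?ltW.
have u2 : u < 2^-1.
  by rewrite -(ltr_pXn2r (n := 2)) ?qualifE/= ?us ?ltW// invr_gt0.
have u02 : 0 < u < 2^-1 by rewrite u0.
have [snu _] := sn_small k01 u02.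
pose f v := v * h (v ^+ 2).
have fu : sn k u = f u by rewrite snE// u0.
rewrite fu in snu; have /andP[fu0 fu2] := snu.
have hs0 : 0 < h s by move: fu0; rewrite /f us pmulr_rgt0.
split => //.
(* The conditions 0 < u < 1/2 and u < e are open, so the inverse relation holds around [u] and may
   be differentiated. *)
have Ff : \near u, (ellipF k \o f) u = u.
  near=> v; rewrite /= /f -snE.
    apply: (sn_small k01 _).2; apply/andP; split; near: v.
      exact: lt_nbhsr.
    exact: lt_nbhsl.
  apply/andP; split; near: v.
    exact: lt_nbhsr.
  exact: lt_nbhsl.
have dh : is_derive (u ^+ 2) 1 h (h' (u ^+ 2)).
  by apply: pseries_snd_diffs c0 c1 c2 _; rewrite us !gtr0_norm.
have df : is_derive u 1 f (h s + 2 * (s * h' s)).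
  have dX : is_derive u 1 (fun v : R => v ^+ 2) (2 * u).
    have := @is_deriveX _ _ id 2 u 1 1 (is_derive_id _ _).
    by rewrite [_%:A]mulr1.
  have dhX : is_derive u 1 (h \o (fun v => v ^+ 2)) (h' (u ^+ 2) * (2 * u)).
    exact: is_derive1_comp.
  have := @is_deriveM _ _ id (h \o (fun v => v ^+ 2)) u 1 _ _
    (is_derive_id _ _) dhX.
  have scaleE (a b : R) : a *: (b : R^o) = a * b by [].
  rewrite !scaleE mulr1 /comp us; congr is_derive.
  by ring: us.
have dF : is_derive (f u) 1 (ellipF k) (ellipF_integrand k (f u)).
  by apply: is_derive_ellipF => //; apply/andP; split => //; lra.
have dFf : is_derive u 1 (ellipF k \o f)
    (ellipF_integrand k (f u) * (h s + 2 * (s * h' s))).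
  exact: is_derive1_comp.
have gf' : ellipF_integrand k (f u) * (h s + 2 * (s * h' s)) = 1.
  have [_ <-] := near_eq_is_derive Ff dFf.
  exact: derive_id.
have g2P : ellipF_integrand k (f u) ^+ 2 * sn_rhs k (f u) = 1.
  by apply: ellipF_integrand_sqr => //; rewrite gtr0_norm//; lra.
have -> : (1 - s * h s ^+ 2) * (1 - k ^+ 2 * (s * h s ^+ 2)) = sn_rhs k (f u).
  by rewrite /sn_rhs /f exprMn us.
apply/eqP; rewrite subr_eq0; apply/eqP.
set D := h s + _ in gf' *; set g := ellipF_integrand _ _ in gf' g2P.
have g20 : g ^+ 2 != 0.
  by apply: contra_eqN g2P => /eqP ->; rewrite mul0r eq_sym oner_eq0.
by apply: (mulfI g20); rewrite g2P -exprMn gf' expr1n.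
Unshelve. all: by end_near. Qed.

Lemma expands_pseries (a : R^nat) (r : R) n : 0 < r -> cvgn (pseries a r) ->
  expands n (fun s => limn (pseries a s)) (\poly_(i < n) a i).
Proof.
move=> r0 ar; have w0 : 0 < r / 2 by rewrite divr_gt0.
have aw : cvgn (pseries (fun i => `|a i|) (r / 2)).
  by apply: is_cvg_pseries_inside_norm ar _; rewrite !gtr0_norm//; lra.
have [B aB] := pseries_trunc n w0 aw; exists B; near=> s.
have s0 : 0 < s by near: s; exact: nbhs_right_gt.
have sw : s <= r / 2 by near: s; exact: nbhs_right_le.
have := aB s; rewrite (gtr0_norm s0) => /(_ sw).
by rewrite big_mkord horner_poly.
Unshelve. all: by end_near. Qed.

(** Expansions respect ring operations, so the equation satisfied by [h] passes to its truncation up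
    to O(s^m). The truncation has m + 1 terms because the derivative loses one. *)
Lemma expands_sn_defect m :
  expands m (fun=> 0) (first_order_defect (k ^+ 2) (\poly_(i < m.+1) c i)).
Proof.
have [r r0 [c0 [c1 _]]] := sn_pseries_cvg.
set p := \poly_(i < m.+1) c i.
have hp : expands m h p.
  by apply: (@expandsW _ m.+1) => //; exact: expands_pseries c0.
have h'p : expands m h' p^`().
  have -> : p^`() = \poly_(i < m) pseries_diffs c i.
    apply/polyP => i; rewrite coef_deriv !coef_poly ltnS.
    by case: ifP => _; rewrite ?mul0rn// /pseries_diffs mulr_natl.
  exact: expands_pseries c1.
have cst (a : R) : expands m (fun=> a) a%:P.
  by exists 0; near=> s; rewrite hornerC subrr normr0 mul0r.
have ex : expands m (@id R) 'X.
  by exists 0; near=> s; rewrite hornerX subrr normr0 mul0r.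
have xh2 := expandsM ex (expandsM hp hp).
have xd := expandsD hp (expandsM (cst 2) (expandsM ex h'p)).
have rhs := expandsM (expandsD (cst 1) (expandsN xh2))
  (expandsD (cst 1) (expandsN (expandsM (cst (k ^+ 2)) xh2))).
have := expandsD (expandsM xd xd) (expandsN rhs).
rewrite /first_order_defect /odd_deriv -mul_polyC -polyC1 !expr2.
apply: near_eq_expands; apply: filterS sn_ode => s [_].
by rewrite !expr2.
Unshelve. all: by end_near. Qed.

Lemma sn_coef0 : c 0%N = 1.
Proof.
have /expands0_coef/(_ 0%N isT) := expands_sn_defect 1.
rewrite /first_order_defect -horner_coef0 /odd_deriv !hornerE !horner_poly.
rewrite !big_ord_recl !big_ord0/= !expr0n/= !mulr0 !mul0r.
rewrite !(addr0, subr0) !mulr1.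
(* The equation at s = 0 reads c_0^2 = 1. If c_0 = -1, then |h(s) + 1| <= B s < 1 for small s,
   against h(s) > 0. *)
move/eqP; rewrite subr_eq0 expr2 -expr2 sqrf_eq1 => /orP[/eqP//|/eqP cN1].
have [r r0 [c0 _]] := sn_pseries_cvg.
have [B hB] := expands_pseries 1 r0 c0.
have Bpos : 0 < (`|B| + 1)^-1 by rewrite invr_gt0 ltr_wpDl.
near (0 : R)^'+ => s.
have s0 : 0 < s by near: s; exact: nbhs_right_gt.
have h0 : 0 < h s by near: s; apply: filterS sn_ode => s [].
have : `|h s - (\poly_(i < 1) c i).[s]| <= B * s ^+ 1 by near: s.
rewrite horner_poly big_ord1 expr0 mulr1 cN1 opprK expr1.
have sB : s < (`|B| + 1)^-1 by near: s; exact: nbhs_right_lt.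
have Bs : s * (`|B| + 1) < 1 by rewrite -ltr_pdivlMr ?div1r// -invr_gt0.
have BB : B * s <= `|B| * s by rewrite ler_wpM2r ?ler_norm// ltW.
by rewrite gtr0_norm ?addr_gt0//; lra.
Unshelve. all: by end_near. Qed.

Lemma sn_coef_rec n :
  (second_order_defect (k ^+ 2) (\poly_(i < n.+3) c i))`_n = 0.
Proof.
(* From n + 3 terms, the first-order defect vanishes below index n + 2 and the second-order one
   below n + 1, hence at [n]. *)
apply: (@second_order_defect_coef _ _ _ n.+1) => //.
  by rewrite coef_poly/= sn_coef0 oner_eq0.
exact: expands0_coef (expands_sn_defect _).
Qed.

End SnSeries.

(** * The graded cone of gamma-positive polynomials *)

Section GammaCone.
Variable R : realType.
Implicit Types f g : {poly R}.

(* [m] is the weighted degree, 'X having weight 2 and [1 + 'X] weight 1. *)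
Inductive gamma_cone : nat -> {poly R} -> Prop :=
| gamma_cone0 m : gamma_cone m 0
| gamma_coneD m f g : gamma_cone m f -> gamma_cone m g -> gamma_cone m (f + g)
| gamma_cone_basis a i j : 0 <= a ->
    gamma_cone (i.*2 + j) (a *: ('X^i * (1 + 'X) ^+ j)).

Lemma gamma_cone1 : gamma_cone 0 1.
Proof.
by have := @gamma_cone_basis 1 0 0 ler01; rewrite scale1r !expr0 mulr1.
Qed.

Lemma gamma_cone1X : gamma_cone 1 (1 + 'X).
Proof.
by have := @gamma_cone_basis 1 0 1 ler01; rewrite scale1r expr0 expr1 mul1r.
Qed.

Lemma gamma_coneX : gamma_cone 2 'X.
Proof.
by have := @gamma_cone_basis 1 1 0 ler01; rewrite scale1r expr0 expr1 mulr1.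
Qed.

Lemma gamma_coneZ m a f : 0 <= a -> gamma_cone m f -> gamma_cone m (a *: f).
Proof.
move=> a0; elim=> [n|n {}f g _ IHf _ IHg|b i j b0].
- by rewrite scaler0; exact: gamma_cone0.
- by rewrite scalerDr; exact: gamma_coneD.
- by rewrite scalerA; apply: gamma_cone_basis; exact: mulr_ge0.
Qed.

Lemma gamma_coneM m n f g :
  gamma_cone m f -> gamma_cone n g -> gamma_cone (m + n) (f * g).
Proof.
move=> + gn; elim=> [p|p {}f f' _ IHf _ IHf'|a i j a0].
- by rewrite mul0r; exact: gamma_cone0.
- by rewrite mulrDl; exact: gamma_coneD.
elim: gn => [p|p {}g g' _ IHg _ IHg'|b i' j' b0].
- by rewrite mulr0; exact: gamma_cone0.
- by rewrite mulrDr; exact: gamma_coneD.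
rewrite -scalerAl -scalerAr scalerA mulrACA -!exprD addnACA -doubleD.
by apply: gamma_cone_basis; exact: mulr_ge0.
Qed.

Lemma gamma_cone_sum (I : Type) (r : seq I) (P : pred I) m (F : I -> {poly R}) :
  (forall i, P i -> gamma_cone m (F i)) ->
  gamma_cone m (\sum_(i <- r | P i) F i).
Proof.
move=> PF; apply: (big_ind (gamma_cone m)) => //; first exact: gamma_cone0.
exact: gamma_coneD.
Qed.

Lemma gamma_cone_expansion m f : gamma_cone m f ->
  exists2 gamma : nat -> R,
    f = \sum_(k < m./2.+1) gamma k *: ('X^k * (1 + 'X) ^+ (m - k.*2)) &
    forall k, 0 <= gamma k.
Proof.
elim=> {m f} [m|m f g _ [u -> u0] _ [v -> v0]|a i j a0].
- by exists (fun=> 0) => //; rewrite big1// => i _; rewrite scale0r.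
- exists (fun k => u k + v k) => [|k]; last exact: addr_ge0.
  by rewrite -big_split/=; apply: eq_bigr => k _; rewrite scalerDl.
(* Since m = 2i + j, the exponent j is m - 2i, and the generator is the single term of index [i]. *)
- exists (fun k => if k == i then a else 0) => [|k]; last by case: ifP.
  have i_lt : (i < (i.*2 + j)./2.+1)%N.
    by rewrite ltnS halfD doubleK odd_double/= add0n leq_addr.
  rewrite (bigD1 (Ordinal i_lt))//= eqxx addKn big1 ?addr0// => k.
  by rewrite -val_eqE/= => /negPf ->; rewrite scale0r.
Qed.

(* The descent in the second half follows by symmetry. *)
Definition centrally_unimodal m f :=
  (forall i, (i <= m)%N -> f`_i = f`_(m - i)) /\
  (forall i, (i.*2 < m)%N -> f`_i <= f`_i.+1) /\ (size f <= m.+1)%N.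

Lemma coef_exp1X j t : ((1 + 'X) ^+ j : {poly R})`_t = 'C(j, t)%:R.
Proof.
elim: j t => [|j IH] t; first by rewrite expr0 coef1 bin0n.
rewrite exprS mulrDl mul1r coefD coefXM !IH.
by case: t => [|t]; rewrite ?bin0 ?addr0// binS natrD.
Qed.

(** From (t + 1) C(j, t + 1) = (j - t) C(j, t) with t + 1 <= j - t. *)
Lemma leq_bin_half j t : (t.*2 < j)%N -> ('C(j, t) <= 'C(j, t.+1))%N.
Proof.
move=> tj; rewrite -(leq_pmul2l (ltn0Sn t)) mul_bin_left leq_mul2r.
by apply/orP; right; rewrite leq_subRL; lia.
Qed.

(** A generator is a binomial row shifted by [i], with centre i + j/2 = m/2. All generators of
    weight [m] share this centre, so sums keep both properties. *)
Lemma centrally_unimodal_gamma_cone m f :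
  gamma_cone m f -> centrally_unimodal m f.
Proof.
elim=> {m f} [m|m f g _ [fs [fu fz]] _ [gs [gu gz]]|a i j a0].
- by split; [|split] => [i|i|]; rewrite ?coef0 ?size_poly0.
- split; [|split].
  + by move=> i im; rewrite !coefD fs// gs.
  + by move=> i im; rewrite !coefD lerD ?fu ?gu.
  + by rewrite (leq_trans (size_polyD _ _))// geq_max fz.
split; [|split].
- move=> n nm; rewrite !coefZ !coefXnM !coef_exp1X.
  case: ltnP => ni.
    case: ltnP => // ni'; rewrite bin_small//; lia.
  case: ltnP => ni'; first by rewrite bin_small//; lia.
  rewrite -bin_sub; last by lia.
  by congr (_ * 'C(_, _)%:R); lia.
- move=> n nm; rewrite !coefZ !coefXnM !coef_exp1X ler_wpM2l//.
  case: ltnP => ni; first by case: ltnP.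
  by rewrite ltnNge (leqW ni)/= ler_nat subSn// leq_bin_half//; lia.
- apply: (leq_trans (size_scale_leq _ _)).
  apply/leq_sizeP => n nm; rewrite coefXnM coef_exp1X.
  case: ltnP => // ni; rewrite bin_small//; lia.
Qed.

End GammaCone.

(** * The recursion lifted to polynomials, and membership in the cone *)

Section TaylorPolys.
Variables (R : realType) (J : nat -> {poly R}).
Hypothesis hJ : sn_taylor_polys J.

(** The coefficient of u^(2n+1) in sn(u, k), as a polynomial in x = k^2. *)
Let a n : {poly R} := ((-1) ^+ n / (n.*2.+1)`!%:R) *: J n.

(** Vanishing to the right of 0 is an expansion of 0 to every order. This turns identities at all x
    = k^2 into polynomial identities. *)
Lemma poly_eq0_on01 (p : {poly R}) :
  (forall x, 0 < x < 1 -> p.[x] = 0) -> p = 0.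
Proof.
move=> p0; apply/polyP => i; rewrite coef0.
apply: (@expands0_coef _ i.+1) => //; exists 0; near=> s.
have s01 : 0 < s < 1.
  by apply/andP; split; near: s; [exact: nbhs_right_gt|exact: nbhs_right_lt].
by rewrite p0 ?subrr ?normr0 ?mul0r.
Unshelve. all: by end_near. Qed.

Lemma sn_series_horner k : 0 < k < 1 -> \forall u \near (0 : R),
  series (fun n => (a n).[k ^+ 2] * u ^+ n.*2.+1) @ \oo --> sn k u.
Proof.
move=> k01; apply: filterS (hJ k01) => u.
rewrite (_ : (fun n => _ * (_ / _)) =
  (fun n => (a n).[k ^+ 2] * u ^+ n.*2.+1))//.
apply/funext => n; rewrite /a hornerZ.
by rewrite [u ^+ _ / _]mulrC mulrA (mulrAC _ (J n).[_]).
Qed.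

Lemma sqrt_itv01 (x : R) : 0 < x < 1 ->
  exists2 k, 0 < k < 1 & k ^+ 2 = x.
Proof.
move=> /andP[x0 x1]; exists (Num.sqrt x); last by rewrite sqr_sqrtr// ltW.
by rewrite sqrtr_gt0 x0/= -sqrtr1 ltr_sqrt.
Qed.

Lemma sn_poly0 : a 0%N = 1.
Proof.
apply/eqP; rewrite -subr_eq0; apply/eqP/poly_eq0_on01 => x.
move=> /sqrt_itv01[k k01 <-]; rewrite hornerD hornerN hornerC.
by rewrite (sn_coef0 k01 (sn_series_horner k01)) subrr.
Qed.

Lemma horner_second_order_defect (x : R) (p : {poly {poly R}}) i :
  ((second_order_defect 'X p)`_i).[x] =
  (second_order_defect x (map_poly (horner_eval x) p))`_i.
Proof.
rewrite !coef_second_order_defect.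
move: (i.+1.*2 * _)%N => N.
rewrite -rmorphXn/= -[in RHS](map_polyX (horner_eval x)).
rewrite -rmorphM/= !coef_map/= !horner_evalE.
by rewrite !(hornerE, hornerMn).
Qed.

Lemma sn_poly_rec n :
  (second_order_defect 'X (\poly_(i < n.+3) a i))`_n = 0.
Proof.
apply: poly_eq0_on01 => x /sqrt_itv01[k k01 <-].
rewrite horner_second_order_defect.
rewrite -[RHS](sn_coef_rec k01 (sn_series_horner k01) n).
congr (second_order_defect _ _)`_n; apply/polyP => i.
rewrite coef_map !coef_poly; case: ifP => _ //=.
by rewrite horner_evalE horner0.
Qed.

(** The sign encodes u -> iu. The bound [m] is there because the induction controls only an initial
    segment of coefficients. *)
Let alternating m (p : {poly {poly R}}) :=
  forall i, (i <= m)%N -> gamma_cone i ((-1) ^+ i * p`_i).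

Lemma alternatingM m p q :
  alternating m p -> alternating m q -> alternating m (p * q).
Proof.
move=> pm qm i im; rewrite coefM mulr_sumr; apply: gamma_cone_sum => j _.
have ji : (j <= i)%N by rewrite -ltnS.
rewrite -{1 2}(subnKC ji) exprD mulrACA; apply: gamma_coneM.
  by apply: pm; rewrite (leq_trans ji).
by apply: qm; rewrite (leq_trans (leq_subr _ _)).
Qed.

(** The recursion of w'' = (1 + x) w + 2 x w^3. The cubic term keeps its factor ['X] visible, so
    that it contributes nothing to the constant coefficient. *)
Lemma sn_poly_step n :
  (forall i, (i <= n)%N -> gamma_cone i ((-1) ^+ i * a i)) ->
  exists2 g, gamma_cone n.+1 ('X * g) &
  (n.+1.*2 * n.+1.*2.+1)%:R *: ((-1) ^+ n.+1 * a n.+1) =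
    (1 + 'X) * ((-1) ^+ n * a n) + 'X * g.
Proof.
move=> an; set p := \poly_(i < n.+3) a i.
have p_alt : alternating n p.
  by move=> i im; rewrite coef_poly; case: ltnP => [_|]; [exact: an|lia].
have := sn_poly_rec n; rewrite coef_second_order_defect -/p.
have -> : p`_n = a n by rewrite coef_poly; case: ltnP => //; lia.
have -> : p`_n.+1 = a n.+1 by rewrite coef_poly; case: ltnP => //; lia.
move=> rec.
exists (2%:R * ((-1) ^+ n.+1 * ('X * p ^+ 3)`_n)).
  (* At index 0 the cubic term vanishes. At n + 1 its sign (-1)^(n+2) is that of coefficient [n] of
     p^3, and the weight is 2 + n. *)
  rewrite coefXM; case: n an p p_alt rec => [|n] an p p_alt rec.
    by rewrite !mulr0; exact: gamma_cone0.
  rewrite mulrCA mulr_natl -scaler_nat; apply: gamma_coneZ => //.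
  rewrite [(-1) ^+ n.+2]exprS [(-1) ^+ n.+1]exprS mulrA mulrNN !mul1r.
  apply: (@gamma_coneM _ 2 n); first exact: gamma_coneX.
  have p3 : alternating n.+1 (p ^+ 3).
    by rewrite !exprS expr0 mulr1; do 2?apply: alternatingM.
  by apply: p3.
rewrite scaler_nat -[_ *+ _]mulr_natl.
move: ((_ * _)%N%:R) rec => N rec.
apply/eqP; rewrite -subr_eq0; apply/eqP.
transitivity ((-1) ^+ n.+1 *
    (N * a n.+1 + (1 + 'X) * a n - 2%:R * 'X * ('X * p ^+ 3)`_n)).
  by rewrite [(-1) ^+ n.+1]exprS; ring.
by rewrite rec mulr0.
Qed.

Lemma sn_poly_cone n : gamma_cone n ((-1) ^+ n * a n).
Proof.
elim/ltn_ind: n => -[_|n IH].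
  by rewrite sn_poly0 mulr1; exact: gamma_cone1.
have [i|g gX rec] := @sn_poly_step n; first exact: IH.
set N := (_ * _)%N in rec.
have N0 : N%:R != 0 :> R by rewrite pnatr_eq0 muln_eq0.
rewrite -[X in gamma_cone _ X]scale1r -(mulVf N0) -scalerA rec.
apply: gamma_coneZ; first by rewrite invr_ge0.
apply: gamma_coneD => //; rewrite -add1n.
by apply: gamma_coneM (gamma_cone1X R) _; exact: IH.
Qed.

(** At x = 0 the recursion only divides by a positive integer. Positivity here is what determines
    the degree of [J n]. *)
Lemma sn_poly_coef0_gt0 n : 0 < ((-1) ^+ n * a n)`_0.
Proof.
elim: n => [|n IH]; first by rewrite sn_poly0 mulr1 coef1.
have [i _|g gX rec] := @sn_poly_step n; first exact: sn_poly_cone.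
have /polyP/(_ 0%N) := rec.
rewrite coefZ coefD coefXM addr0 [(1 + 'X) * _]mulrDl mul1r coefD coefXM
  addr0 => eq0.
by move: IH; rewrite -eq0 pmulr_rgt0// ltr0n muln_gt0.
Qed.

Lemma sn_polyE n : J n = (n.*2.+1)`!%:R *: ((-1) ^+ n * a n).
Proof.
have -> : (-1) ^+ n * a n = (-1) ^+ n *: a n.
  by rewrite -mul_polyC rmorphXn rmorphN1.
rewrite /a !scalerA -!mulrA (mulrA ((-1) ^+ n)) -expr2 sqrr_sign mul1r.
by rewrite mulfV ?scale1r// pnatr_eq0 -lt0n fact_gt0.
Qed.

End TaylorPolys.

(** * The exact degree, gamma-positivity and unimodality *)

Theorem theorem3 (R : realType) (J : nat -> {poly R})
    (hJ : sn_taylor_polys J) (n : nat) :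
  gamma_positive (J n) /\ symmetric_poly (J n) /\ unimodal_poly (J n).
Proof.
have Jn := sn_polyE J n.
have Jcone : gamma_cone n (J n).
  by rewrite Jn; apply: gamma_coneZ; [exact: ler0n|exact: sn_poly_cone].
have J0 : 0 < (J n)`_0.
  rewrite Jn coefZ pmulr_rgt0; first exact: sn_poly_coef0_gt0.
  by rewrite ltr0n fact_gt0.
have [Jsym [Jup Jsize]] := centrally_unimodal_gamma_cone Jcone.
have degJ : deg (J n) = n.
  rewrite /deg; suff -> : size (J n) = n.+1 by [].
  (* The cone only bounds the degree by [n]; symmetry makes the coefficient of index [n] equal to
     the positive constant one. *)
  apply/eqP; rewrite eqn_leq Jsize ltnNge/=; apply: contraL J0 => Jn0.
  by rewrite Jsym// subn0 nth_default// ltxx.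
have sJ : symmetric_poly (J n) by rewrite /symmetric_poly degJ.
split; [|split] => //.
  split => //; rewrite degJ.
  by have [gamma ->] := gamma_cone_expansion Jcone; exists gamma.
exists n./2; rewrite degJ; first lia.
split => i; first by move=> ?; apply: Jup; lia.
(* Reflection i -> n - i turns descent past the middle into ascent before it. *)
move=> /andP[ni i_n]; rewrite [leLHS]Jsym// [leRHS]Jsym 1?ltnW//.
have -> : (n - i = (n - i.+1).+1)%N by lia.
by apply: Jup; lia.
Qed.
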